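(* Let $\mathbb K=\mathbb Q_p$, let $\mathbb O\subset\mathbb K$ be the ring of integers, let $g$ and $h$ be block matrices over $\mathbb K$ of sizes $\alpha+N_1$ and $\alpha+N_2$ respectively (considered up to conjugation by $\mathrm{GL}(N_1,\mathbb O)$, respectively $\mathrm{GL}(N_2,\mathbb O)$), and let $S$ be a lattice in $\mathbb K^2$. Then $$\chi_{g\circ h}(S)=\chi_g(S)\,\chi_h(S).$$
   Context: A lattice in $\mathbb K^n$ is a compact $\mathbb O$-submodule $R\subset\mathbb K^n$ such that $\mathbb K\cdot R=\mathbb K^n$. The group $\mathrm{GL}(N,\mathbb O)$ acts on block matrices of size $\alpha+N$ by conjugation by $\begin{pmatrix} 1_\alpha & 0 \\ 0 & u \end{pmatrix}$. For a block matrix $g=\begin{pmatrix} a & b \\ c & d \end{pmatrix}$ over $\mathbb K$ of size $\alpha+N$ and a lattice $R\subset\mathbb K^2$, consider the lattice $R\otimes\mathbb O^N\subset\mathbb K^2\otimes\mathbb K^N=\mathbb K^N\oplus\mathbb K^N$. Then $\chi_g(R)\subset\mathbb K^\alpha\oplus\mathbb K^\alpha$ is the set of all $q\oplus p$ for which there is $y\oplus x\in R\otimes\mathbb O^N$ such that $\begin{pmatrix} q \\ y \end{pmatrix}=\begin{pmatrix} a & b \\ c & d \end{pmatrix}\begin{pmatrix} p \\ x \end{pmatrix}$; $\chi_g$ is regarded as a map from lattices in $\mathbb K^2$ to lattices in $\mathbb K^\alpha\oplus\mathbb K^\alpha$. For $g=\begin{pmatrix} a & b \\ c & d \end{pmatrix}$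 and $h=\begin{pmatrix} p & q \\ r & t \end{pmatrix}$ of sizes $\alpha+N_1$ and $\alpha+N_2$, $$g\circ h=\begin{pmatrix} a & b & 0 \\ c & d & 0 \\ 0 & 0 & 1 \end{pmatrix}\begin{pmatrix} p & 0 & q \\ 0 & 1 & 0 \\ r & 0 & t \end{pmatrix}=\begin{pmatrix} ap & b & aq \\ cp & d & cq \\ r & 0 & t \end{pmatrix},$$ a block matrix of size $\alpha+(N_1+N_2)$. The product $PQ$ of lattices $P,Q\subset\mathbb K^\alpha\oplus\mathbb K^\alpha$ is the set of all $u\oplus w\in\mathbb K^\alpha\oplus\mathbb K^\alpha$ such that there is $v\in\mathbb K^\alpha$ satisfying $u\oplus v\in P$, $v\oplus w\in Q$ (the usual product of relations). *)

(* Defs.v *)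
From HB Require Import structures.
From mathcomp Require Import all_boot all_order all_algebra.
From mathcomp Require Import all_classical topology.

Set Implicit Arguments.
Unset Strict Implicit.
Unset Printing Implicit Defensive.

Import GRing.Theory.

Local Open Scope classical_set_scope.
Local Open Scope ring_scope.

(* The ring of integers of Q_p is the inverse limit of the rings Z/p^n.  Its  *)
(* elements are the sequences of residues, represented in [0, p^n).           *)

Definition coherent (p : nat) (f : nat -> int) : Prop :=
  forall n, f n = (f n.+1 %% p%:Z ^+ n)%Z.

Record padic_int (p : nat) (p_pr : prime p) := PadicInt {
  digits :> nat -> int;
  _ : `[< coherent p digits >]
}.

Section PadicInt.
Variables (p : nat) (p_pr : prime p).

Local Notation T := (padic_int p_pr).
Local Notation q n := (p%:Z ^+ n).

HB.instance Definition _ := [isSub for @digits p p_pr].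
HB.instance Definition _ := [Choice of padic_int p_pr by <:].

Lemma padic_intE (x : T) n : x n = (x n.+1 %% q n)%Z.
Proof. by case: x => f /= /asboolP. Qed.

Lemma padic_int_modz (x : T) n : (x n %% q n)%Z = x n.
Proof. by rewrite padic_intE modz_mod. Qed.

Lemma padic_intP (x y : T) : (forall n, x n = y n) -> x = y.
Proof. by move=> xy; apply: val_inj; apply/funext. Qed.

Lemma modz_modX (m : int) i n : (i <= n)%N ->
  ((m %% q n)%Z %% q i)%Z = (m %% q i)%Z.
Proof.
by move=> le_in; rewrite [in RHS](divz_eq m (q n)) -(subnK le_in) exprD mulrA modzMDl.
Qed.

Lemma padic_int_modX (x : T) i n : (i <= n)%N -> (x n %% q i)%Z = x i.
Proof.
elim: n => [|n IHn]; first by rewrite leqn0 => /eqP->; exact: padic_int_modz.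
rewrite leq_eqVlt => /predU1P[->|]; first exact: padic_int_modz.
by rewrite ltnS => le_in; rewrite -(modz_modX _ le_in) -padic_intE IHn.
Qed.

Lemma coherent_mod (f : nat -> int) :
    (forall n, (f n.+1 %% q n)%Z = (f n %% q n)%Z) ->
  coherent p (fun n => (f n %% q n)%Z).
Proof. by move=> fS n /=; rewrite modz_modX. Qed.

Definition padic_int_of f fS : T := PadicInt p_pr (asboolT (@coherent_mod f fS)).

Fact add_subproof (x y : T) n : ((x n.+1 + y n.+1) %% q n)%Z = ((x n + y n) %% q n)%Z.
Proof. by rewrite -modzDm -!padic_intE. Qed.

Fact opp_subproof (x : T) n : ((- x n.+1) %% q n)%Z = ((- x n) %% q n)%Z.
Proof. by rewrite -modzNm -padic_intE. Qed.

Fact mul_subproof (x y : T) n : ((x n.+1 * y n.+1) %% q n)%Z = ((x n * y n) %% q n)%Z.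
Proof. by rewrite -modzMm -!padic_intE. Qed.

Definition padic_int_cst (m : int) : T := @padic_int_of (fun=> m) (fun=> erefl).
Definition padic_int_add (x y : T) : T := padic_int_of (add_subproof x y).
Definition padic_int_opp (x : T) : T := padic_int_of (opp_subproof x).
Definition padic_int_mul (x y : T) : T := padic_int_of (mul_subproof x y).

Fact padic_int_addA : associative padic_int_add.
Proof. by move=> x y z; apply: padic_intP => n /=; rewrite modzDml modzDmr addrA. Qed.

Fact padic_int_addC : commutative padic_int_add.
Proof. by move=> x y; apply: padic_intP => n /=; rewrite addrC. Qed.

Fact padic_int_add0 : left_id (padic_int_cst 0) padic_int_add.
Proof. by move=> x; apply: padic_intP => n /=; rewrite modzDml add0r padic_int_modz. Qed.

Fact padic_int_addN : left_inverse (padic_int_cst 0) padic_int_opp padic_int_add.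
Proof. by move=> x; apply: padic_intP => n /=; rewrite modzDml addNr. Qed.

HB.instance Definition _ := GRing.isZmodule.Build (padic_int p_pr)
  padic_int_addA padic_int_addC padic_int_add0 padic_int_addN.

Fact padic_int_mulA : associative padic_int_mul.
Proof. by move=> x y z; apply: padic_intP => n /=; rewrite modzMml modzMmr mulrA. Qed.

Fact padic_int_mulC : commutative padic_int_mul.
Proof. by move=> x y; apply: padic_intP => n /=; rewrite mulrC. Qed.

Fact padic_int_mul1 : left_id (padic_int_cst 1) padic_int_mul.
Proof. by move=> x; apply: padic_intP => n /=; rewrite modzMml mul1r padic_int_modz. Qed.

Fact padic_int_mulD : left_distributive padic_int_mul padic_int_add.
Proof.
by move=> x y z; apply: padic_intP => n /=; rewrite modzMml modzDm mulrDl.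
Qed.

Fact padic_int_1neq0 : padic_int_cst 1 != 0.
Proof.
apply/eqP => /(congr1 (fun x : T => x 1%N)) /= /eqP.
by rewrite expr1 mod0z (sameP eqP dvdz_mod0P) dvdz1 gtn_eqF ?prime_gt1.
Qed.

HB.instance Definition _ := GRing.Zmodule_isComNzRing.Build (padic_int p_pr)
  padic_int_mulA padic_int_mulC padic_int_mul1 padic_int_mulD padic_int_1neq0.

Definition padic_int_unit : {pred T} := fun x => `[< exists y, y * x = 1 >].

Definition padic_int_inv (x : T) : T :=
  if x \in padic_int_unit then xget x [set y | y * x = 1] else x.

Fact padic_int_mulV : {in padic_int_unit, left_inverse 1 padic_int_inv *%R}.
Proof.
move=> x Ux; rewrite /padic_int_inv Ux; have /asboolP[y yx] := Ux.
exact: (xgetI x (P := [set y | y * x = 1]) yx).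
Qed.

Fact padic_int_unitPl (x y : T) : y * x = 1 -> padic_int_unit x.
Proof. by move=> yx; apply/asboolP; exists y. Qed.

Fact padic_int_inv_out : {in [predC padic_int_unit], padic_int_inv =1 id}.
Proof. by move=> x /negPf Ux; rewrite /padic_int_inv Ux. Qed.

HB.instance Definition _ := GRing.ComNzRing_hasMulInverse.Build (padic_int p_pr)
  padic_int_mulV padic_int_unitPl padic_int_inv_out.

Lemma padic_int_neq0 (x : T) : x != 0 -> exists i, forall n, (i <= n)%N -> ~~ (q i %| x n)%Z.
Proof.
move=> x0; have [i xi] : exists i, x i != 0.
  apply: contrapT => /forallNP x_eq0; move/eqP: x0; apply; apply: padic_intP => n /=.
  by rewrite mod0z; apply/eqP/negPn/negP/x_eq0.
exists i => n le_in; apply: contra xi => /dvdz_mod0P.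
by rewrite padic_int_modX // => ->.
Qed.

Fact padic_int_integral (x y : T) : x * y = 0 -> (x == 0) || (y == 0).
Proof.
move=> /(congr1 (@digits p p_pr)) xy0; apply: contraT.
rewrite negb_or => /andP[/padic_int_neq0[i xi] /padic_int_neq0[j yj]].
have: (q (i + j) %| x (i + j)%N * y (i + j)%N)%Z.
  by apply/dvdz_mod0P; move/(congr1 (@^~ (i + j)%N)): xy0 => /= ->; rewrite mod0z.
have := yj _ (leq_addl i j); have := xi _ (leq_addr j i).
rewrite !dvdzE !abszX abszM /= => px py.
case: (posnP `|x (i + j)%N|) px => [->|x_gt0 px]; first by rewrite dvdn0.
case: (posnP `|y (i + j)%N|) py => [->|y_gt0 py]; first by rewrite dvdn0.
move: px py; rewrite !pfactor_dvdn ?muln_gt0 ?x_gt0 // lognM // -!ltnNge => px py.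
by rewrite leqNgt (leq_trans _ (leq_add px py)) // addSn addnS ltnS leqnSn.
Qed.

HB.instance Definition _ := GRing.ComUnitRing_isIntegral.Build (padic_int p_pr)
  padic_int_integral.

End PadicInt.

Section Padic.
Variables (p : nat) (p_pr : prime p).

Definition padic : Type := {fraction padic_int p_pr}.

HB.instance Definition _ := GRing.Field.on padic.

Definition padic_of_int (x : padic_int p_pr) : padic := FracField.tofrac x.

HB.instance Definition _ := GRing.isZmodMorphism.Build
  (padic_int p_pr) padic padic_of_int (@tofrac_is_zmod_morphism _).
HB.instance Definition _ := GRing.isMonoidMorphism.Build
  (padic_int p_pr) padic padic_of_int (@tofrac_is_monoid_morphism _).

(* The p-adic topology: the balls x + p^k O form a basis of neighbourhoods of *)
(* x.                                                                         *)
Definition padic_nbhs (x : padic) : set_system padic :=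
  [set A | exists k : nat, forall z, A (x + p%:R ^+ k * padic_of_int z)].

HB.instance Definition _ := hasNbhs.Build padic padic_nbhs.

Fact padic_nbhs_filter (x : padic) : ProperFilter (nbhs x).
Proof.
apply: Build_ProperFilter_ex => [A [k Ak]|]; first by exists (x + p%:R ^+ k * padic_of_int 0).
split=> [|A B [k Ak] [l Bl]|A B AB [k Ak]]; first by exists 0%N.
- exists (k + l)%N => z; split.
    have := Ak (p%:R ^+ l * z).
    by rewrite rmorphM rmorphXn rmorph_nat mulrA -exprD.
  have := Bl (p%:R ^+ k * z).
  by rewrite rmorphM rmorphXn rmorph_nat mulrA -exprD addnC.
- by exists k => z; apply: AB.
Qed.

Fact padic_nbhs_singleton (x : padic) (A : set padic) : nbhs x A -> A x.
Proof. by move=> [k /(_ 0)]; rewrite rmorph0 mulr0 addr0. Qed.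

Fact padic_nbhs_nbhs (x : padic) (A : set padic) : nbhs x A -> nbhs x (nbhs^~ A).
Proof.
move=> [k Ak]; exists k => z; exists k => t.
by rewrite -addrA -mulrDr -rmorphD; apply: Ak.
Qed.

HB.instance Definition _ := Nbhs_isNbhsTopological.Build padic
  padic_nbhs_filter padic_nbhs_singleton padic_nbhs_nbhs.

End Padic.

Section Lattice.
Variables (p : nat) (p_pr : prime p).

Local Notation O := (padic_int p_pr).
Local Notation K := (padic p_pr).
Local Notation iota := (@padic_of_int p p_pr).

Definition is_Osubmodule n (R : set 'cV[K]_n) : Prop :=
  [/\ R 0, forall u v, R u -> R v -> R (u + v)
    & forall (a : O) v, R v -> R (iota a *: v)].

Definition is_lattice n (R : set 'cV[K]_n) : Prop :=
  [/\ compact R, is_Osubmodule R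
    & [set a *: v | a in setT & v in R] = setT].

(* R (x) O^N inside K^2 (x) K^N = K^N (+) K^N, where r (x) w is identified    *)
(* with (r_0 w, r_1 w).                                                       *)
Definition tensorO (R : set 'cV[K]_2) N : set ('cV[K]_N * 'cV[K]_N) :=
  [set yx | exists m (r : 'I_m -> 'cV[K]_2) (w : 'I_m -> 'cV[O]_N),
    (forall i, R (r i)) /\
    yx = (\sum_i r i 0 0 *: map_mx iota (w i),
          \sum_i r i 1 0 *: map_mx iota (w i))].

Variable alpha : nat.

(* A plain set: it need not be compact or spanning (for g = 1 it is the       *)
(* diagonal).                                                                 *)
Definition chi N (g : 'M[K]_(alpha + N)) (R : set 'cV[K]_2) :
    set ('cV[K]_alpha * 'cV[K]_alpha) :=
  [set qp | exists2 yx, tensorO R yx &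
    col_mx qp.1 yx.1 = g *m col_mx qp.2 yx.2].

Definition GLO_conjugate N (g g' : 'M[K]_(alpha + N)) : Prop :=
  exists2 u : 'M[O]_N, u \in unitmx &
    let U : 'M[K]_(alpha + N) := block_mx 1%:M 0 0 (map_mx iota u) in
    g' = U *m g *m invmx U.

Definition circ N1 N2 (g : 'M[K]_(alpha + N1)) (h : 'M[K]_(alpha + N2)) :
    'M[K]_(alpha + (N1 + N2)) :=
  block_mx (ulsubmx g) (row_mx (ursubmx g) 0)
           (col_mx (dlsubmx g) 0) (block_mx (drsubmx g) 0 0 1%:M) *m
  block_mx (ulsubmx h) (row_mx 0 (ursubmx h))
           (col_mx 0 (dlsubmx h)) (block_mx 1%:M 0 0 (drsubmx h)).

Lemma circE N1 N2 (a : 'M[K]_alpha) b c (d : 'M_N1) a' b' c' (d' : 'M_N2) :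
  circ (block_mx a b c d) (block_mx a' b' c' d') =
  block_mx (a *m a') (row_mx b (a *m b'))
           (col_mx (c *m a') c') (block_mx d (c *m b') 0 d').
Proof.
rewrite /circ !(block_mxKul, block_mxKur, block_mxKdl, block_mxKdr).
rewrite !mulmx_block mul_row_col mul_mx_row mul_row_block mul_col_mx.
rewrite mul_block_col mul_col_row.
by rewrite !(mul0mx, mulmx0, mul1mx, mulmx1, addr0, add0r, add_row_mx,
  add_col_mx, add_block_mx).
Qed.

(* Composed from left to right, unlike the notation "\;" of relation_scope.   *)
Definition rel_prod (P Q : set ('cV[K]_alpha * 'cV[K]_alpha)) :
    set ('cV[K]_alpha * 'cV[K]_alpha) :=
  [set uw | exists v, P (uw.1, v) /\ Q (v, uw.2)].

End Lattice.

(* Main.v *)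
(* Applying [circ g h] to a vector is applying [h] to the outer block and then *)
(* [g] to its output, the inner blocks being processed independently.  As      *)
(* [S (x) O^(N1 + N2)] is the direct sum of [S (x) O^N1] and [S (x) O^N2], the *)
(* intermediate vector is the one witnessing the product of relations.         *)
(* Conjugation does not matter because [S (x) O^N] is stable under matrices    *)
(* over [O].                                                                   *)

Require Import Defs.
From HB Require Import structures.
From mathcomp Require Import all_boot all_order all_algebra.
From mathcomp Require Import all_classical topology.

Section ChiCirc.
Set Implicit Arguments.
Unset Strict Implicit.
Import GRing.Theory.
Local Open Scope classical_set_scope.
Local Open Scope ring_scope.

Variables (p : nat) (p_pr : prime p).

Local Notation O := (padic_int p_pr).
Local Notation K := (padic p_pr).
Local Notation iota := (@padic_of_int p p_pr).

(** Everything rests on two facts. By [circ_mul_col], an equation for [circ g h] is a pair of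
    equations for [g] and [h] sharing an outer vector [w]; by [tensorO_col_mx], the constraint on
    the inner vectors splits along [N1 + N2]. Projecting [w] out is the product of relations, which
    gives [chi_circ]; [chi_GLO] then passes to conjugacy classes. *)

Lemma tensorO_mulmx (R : set 'cV[K]_2) M N (u : 'M[O]_(M, N)) y x :
  tensorO R (y, x) ->
  tensorO R (map_mx iota u *m y, map_mx iota u *m x).
Proof.
case=> m [r] [w] [Rr [-> ->]]; exists m, r, (fun i => u *m w i); split=> //.
by congr pair; rewrite mulmx_sumr; apply: eq_bigr => i _;
  rewrite map_mxM scalemxAr.
Qed.

Lemma tensorO_add (R : set 'cV[K]_2) N (y x y' x' : 'cV[K]_N) :
  tensorO R (y, x) -> tensorO R (y', x') -> tensorO R (y + y', x + x').
Proof.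
case=> m [r] [w] [Rr [-> ->]] [m'] [r'] [w'] [Rr' [-> ->]].
(* The two families of pure tensors are concatenated. *)
exists (m + m')%N.
exists (fun i => match fintype.split i with inl j => r j | inr j => r' j end).
exists (fun i => match fintype.split i with inl j => w j | inr j => w' j end).
split=> [i|]; first by case: (fintype.split i).
have splitl j : fintype.split (lshift m' j) = inl j by exact: (unsplitK (inl j)).
have splitr j : fintype.split (rshift m j) = inr j by exact: (unsplitK (inr j)).
by congr pair; rewrite big_split_ord /=; congr (_ + _); apply: eq_bigr => i _;
  rewrite ?splitl ?splitr.
Qed.

(** The projections and inclusions of the summands are matrices over [O], so [tensorO_mulmx] applies
    to them; [tensorO_add] reassembles the two parts. *)
Lemma tensorO_col_mx (R : set 'cV[K]_2) N1 N2
    (y1 x1 : 'cV[K]_N1) (y2 x2 : 'cV[K]_N2) :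
  tensorO R (col_mx y1 y2, col_mx x1 x2) <->
  tensorO R (y1, x1) /\ tensorO R (y2, x2).
Proof.
split=> [Ryx|[/(@tensorO_mulmx _ _ _ (col_mx 1%:M 0)) R1]].
  split.
    have := @tensorO_mulmx _ _ _ (row_mx 1%:M 0) _ _ Ryx.
    by rewrite map_row_mx map_mx1 map_mx0 !mul_row_col !mul1mx !mul0mx !addr0.
  have := @tensorO_mulmx _ _ _ (row_mx 0 1%:M) _ _ Ryx.
  by rewrite map_row_mx map_mx1 map_mx0 !mul_row_col !mul1mx !mul0mx !add0r.
move=> /(@tensorO_mulmx _ _ _ (col_mx 0 1%:M)) R2.
(* The heights of the zero blocks were left free and are fixed here. *)
have := tensorO_add (R1 N2) (R2 N1).
by rewrite !map_col_mx !map_mx1 !map_mx0 !mul_col_mx !mul1mx !mul0mx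
  !add_col_mx !addr0 !add0r.
Qed.

Section Conjugation.
Variables alpha N : nat.

Local Notation blk u :=
  (block_mx 1%:M 0 0 (map_mx iota u) : 'M[K]_(alpha + N)).

Lemma block_GLO_mulV (u : 'M[O]_N) : u \in unitmx -> blk u *m blk (invmx u) = 1%:M.
Proof.
move=> Uu; rewrite mulmx_block !(mul0mx, mulmx0, mul1mx, addr0, add0r).
by rewrite -map_mxM mulmxV // map_mx1 -scalar_mx_block.
Qed.

Lemma block_GLO_unit (u : 'M[O]_N) : u \in unitmx -> blk u \in unitmx.
Proof. by move=> Uu; have [-> _] := mulmx1_unit (block_GLO_mulV Uu). Qed.

Lemma block_GLO_inv (u : 'M[O]_N) : u \in unitmx -> invmx (blk u) = blk (invmx u).
Proof.
move=> Uu; rewrite -[RHS](mulKmx (block_GLO_unit Uu)).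
by rewrite block_GLO_mulV // mulmx1.
Qed.

Lemma GLO_conjugate_sym (g g' : 'M[K]_(alpha + N)) :
  GLO_conjugate g g' -> GLO_conjugate g' g.
Proof.
case=> u Uu -> /=; exists (invmx u); first by rewrite unitmx_inv.
rewrite /= -block_GLO_inv // invmxK !mulmxA mulVmx ?block_GLO_unit //.
by rewrite mul1mx mulmxKV // block_GLO_unit.
Qed.

(** The change of inner variables [(y, x)] to [(u y, u x)] absorbs the conjugation and leaves the
    outer vectors alone. The reverse inclusion comes from [GLO_conjugate_sym]. *)
Lemma chi_GLO_sub (R : set 'cV[K]_2) (g g' : 'M[K]_(alpha + N)) :
  GLO_conjugate g g' -> chi g R `<=` chi g' R.
Proof.
case=> u Uu -> [q v] [[y x] Ryx /= eq_g].
exists (map_mx iota u *m y, map_mx iota u *m x); first exact: tensorO_mulmx.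
have blkE (a : 'cV[K]_alpha) b : col_mx a (map_mx iota u *m b) = blk u *m col_mx a b.
  by rewrite mul_block_col !mul0mx mul1mx addr0 add0r.
by rewrite /= !blkE eq_g -!mulmxA mulKmx ?block_GLO_unit.
Qed.

Lemma chi_GLO (R : set 'cV[K]_2) (g g' : 'M[K]_(alpha + N)) :
  GLO_conjugate g g' -> chi g' R = chi g R.
Proof.
by move=> gg'; apply/seteqP; split; apply: chi_GLO_sub => //;
  apply: GLO_conjugate_sym.
Qed.

End Conjugation.

Lemma circ_mul_col alpha N1 N2 (g : 'M[K]_(alpha + N1)) (h : 'M[K]_(alpha + N2))
    (q v : 'cV[K]_alpha) y1 y2 x1 x2 :
  col_mx q (col_mx y1 y2) = circ g h *m col_mx v (col_mx x1 x2) <->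
  exists2 w, col_mx q y1 = g *m col_mx w x1 & col_mx w y2 = h *m col_mx v x2.
Proof.
rewrite -[g]submxK -[h]submxK circE.
move: (ulsubmx g) (ursubmx g) (dlsubmx g) (drsubmx g) => a b c d.
move: (ulsubmx h) (ursubmx h) (dlsubmx h) (drsubmx h) => a' b' c' d'.
rewrite !mul_block_col mul_row_col mul_col_mx add_col_mx mul0mx add0r.
(* Factors out the outer output of [h]; used with [s] equal to [a] and to [c]. *)
have swap m (s : 'M[K]_(m, alpha)) (t : 'cV[K]_m) :
    s *m a' *m v + (t + s *m b' *m x2) = s *m (a' *m v + b' *m x2) + t.
  by rewrite mulmxDr !mulmxA [t + _]addrC addrA.
rewrite !swap; split=> [/eq_col_mx[-> /eq_col_mx[-> ->]]|[w]].
  (* The witness is the outer component of [h] applied to [(v, x2)]. *)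
  by exists (a' *m v + b' *m x2); rewrite ?mul_block_col.
by rewrite !mul_block_col => /eq_col_mx[-> ->] /eq_col_mx[-> ->].
Qed.

Lemma chi_circ alpha N1 N2 (g : 'M[K]_(alpha + N1)) (h : 'M[K]_(alpha + N2))
    (R : set 'cV[K]_2) :
  chi (circ g h) R = rel_prod (chi g R) (chi h R).
Proof.
apply/seteqP; split=> [[q v]|[q v]] /=.
  case=> -[y x]; rewrite -[y]vsubmxK -[x]vsubmxK /=.
  move=> /tensorO_col_mx[R1 R2] /circ_mul_col[w Eg Eh]; exists w; split.
    by exists (usubmx y, usubmx x).
  by exists (dsubmx y, dsubmx x).
case=> w [[[y1 x1] R1 Eg] [[y2 x2] R2 Eh]].
exists (col_mx y1 y2, col_mx x1 x2); first exact/tensorO_col_mx.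
by apply/circ_mul_col; exists w.
Qed.

End ChiCirc.

(** The matrices [g'], [h'] and [k] are arbitrary representatives of the three conjugacy classes, so
    the identity is one between classes. *)
Theorem theorem4p2 (p : nat) (p_pr : prime p) (alpha N1 N2 : nat)
    (g g' : 'M[padic p_pr]_(alpha + N1)) (h h' : 'M[padic p_pr]_(alpha + N2))
    (k : 'M[padic p_pr]_(alpha + (N1 + N2))) (S : set 'cV[padic p_pr]_2) :
  GLO_conjugate g g' -> GLO_conjugate h h' -> GLO_conjugate (circ g h) k ->
  is_lattice S ->
  chi k S = rel_prod (chi g' S) (chi h' S).
Proof.
move=> gg' hh' ghk _.
by rewrite (chi_GLO _ ghk) (chi_GLO _ gg') (chi_GLO _ hh') chi_circ.
Qed.
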